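(* Let $D$ be a digraph. The detour and bypass operations commute with disjoint vertex contractions: if $U, V_1, \dots, V_m \subseteq V(D)$ are (pairwise) disjoint, then $$(D \uparrow U) / \{V_1,\dots,V_m\} = (D / \{V_1,\dots,V_m\}) \uparrow U \quad \text{and} \quad (D \upuparrows U) / \{V_1,\dots,V_m\} = (D / \{V_1,\dots,V_m\}) \upuparrows U.$$
   Context: Digraphs are finite and loopless, with no parallel arcs; $V(D)$ is the vertex set and $\mu_D : V(D)^2 \to \{0,1\}$ the adjacency matrix ($\mu_D(x,y)=1$ iff $(x,y)$ is an arc). For $v \in V(D)$ let $P(D)_v := \{x \in V(D)\setminus\{v\} : \mu_D(x,v) \neq 0\}$ (predecessors) and $S(D)_v := \{x \in V(D) \setminus \{v\} : \mu_D(v,x) \ne 0\}$ (successors). The detour $D \uparrow v$ is the digraph with $V(D \uparrow v) := V(D)$ and $$\mu_{D \uparrow v}(x,y) := \begin{cases} 0 & \text{if } (x,y) \in [P(D)_v \times \{v\}] \cup [\{v\} \times S(D)_v]; \\ 1 & \text{if } (x,y) \in P(D)_v \times S(D)_v \text{ and } x \neq y; \\ \mu_D(x,y) & \text{otherwise.}\end{cases}$$ For $U = \{u_1,\dots,u_k\} \subseteq V(D)$, $D \uparrow U := (\dots(D \uparrow u_1) \dots) \uparrow u_k$ (for digraphs this does not depend on the order of the $u_j$), and $D \upuparrows U := (D \uparrow U) - U$ is obtained by then deleting the vertices in $U$. For $W \subseteq V(D)$, the vertex contraction $D / W$ is the digraph whose vertex set is $V(D) \setminus W$ together with one new vertex,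 denoted $\{W\}$, representing $W$, with, for $x,y \in V(D) \setminus W$, $\mu_{D/W}(x,\{W\}) := \sum_{z \in W} \mu_D(x,z)$, $\mu_{D/W}(\{W\},x) := \sum_{z \in W} \mu_D(z,x)$, $\mu_{D/W}(x,y) := \mu_D(x,y)$, and $\mu_{D/W}(\{W\},\{W\}) = 0$ (no loops). Here sums are taken in the Boolean semiring $(\{0,1\},\lor,\land)$, i.e., they are logical disjunctions. For disjoint $V_1,\dots,V_m \subseteq V(D)$, $D / \{V_1,\dots,V_m\} := (\dots(D/V_1)\dots)/V_m$. *)

(* Defs.v *)
From HB Require Import structures.
From mathcomp Require Import all_boot.

Set Implicit Arguments.
Unset Strict Implicit.
Unset Printing Implicit Defensive.

(* The vertex set is a subset of a finite ambient type T, rather than the whole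
   of T, so that deleting vertices stays within digraphs on T. The matrix is
   required to vanish off the vertex set: hence two digraphs on T are equal (as
   records) iff they have the same vertices and the same adjacency matrix. *)
Definition loopless_on (T : finType) (V : {set T}) (m : {ffun T * T -> bool}) :=
  [forall x, forall y, m (x, y) ==> [&& x \in V, y \in V & x != y]].

Record digraph (T : finType) := Digraph {
  vertices : {set T};
  adjacency : {ffun T * T -> bool};
  _ : loopless_on vertices adjacency
}.

Definition mu (T : finType) (D : digraph T) (x y : T) : bool :=
  adjacency D (x, y).

Lemma mu_vertices (T : finType) (D : digraph T) (x y : T) :
  mu D x y -> [&& x \in vertices D, y \in vertices D & x != y].
Proof. by rewrite /mu; case: D => V m /= /forallP/(_ x)/forallP/(_ y)/implyP. Qed.

Definition predecessors (T : finType) (D : digraph T) (v : T) : {set T} :=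
  [set x in vertices D :\ v | mu D x v].

Definition successors (T : finType) (D : digraph T) (v : T) : {set T} :=
  [set x in vertices D :\ v | mu D v x].

Definition detour_adjacency (T : finType) (D : digraph T) (v : T) :
    {ffun T * T -> bool} :=
  [ffun p => let: (x, y) := p in
    if (x \in predecessors D v) && (y == v) || (x == v) && (y \in successors D v)
    then false
    else if [&& x \in predecessors D v, y \in successors D v & x != y]
    then true
    else mu D x y].

Lemma detour_proof (T : finType) (D : digraph T) (v : T) :
  loopless_on (vertices D) (detour_adjacency D v).
Proof.
apply/forallP => x; apply/forallP => y; apply/implyP.
rewrite ffunE; case: ifP => // _; case: ifP => [|_ /mu_vertices //].
by rewrite !inE => /and3P[/andP[/andP[_ ->] _] /andP[/andP[_ ->] _] ->].
Qed.

Definition detour1 (T : finType) (D : digraph T) (v : T) : digraph T :=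
  Digraph (detour_proof D v).

(* Detours at distinct vertices commute, so the enumeration order of U used
   here does not matter. *)
Definition detour (T : finType) (D : digraph T) (U : {set T}) : digraph T :=
  foldl (@detour1 T) D (enum U).

Definition delete_adjacency (T : finType) (D : digraph T) (U : {set T}) :
    {ffun T * T -> bool} :=
  [ffun p => let: (x, y) := p in [&& x \notin U, y \notin U & mu D x y]].

Lemma delete_proof (T : finType) (D : digraph T) (U : {set T}) :
  loopless_on (vertices D :\: U) (delete_adjacency D U).
Proof.
apply/forallP => x; apply/forallP => y; apply/implyP.
by rewrite ffunE !inE => /and3P[-> -> /mu_vertices].
Qed.

Definition delete (T : finType) (D : digraph T) (U : {set T}) : digraph T :=
  Digraph (delete_proof D U).

Definition bypass (T : finType) (D : digraph T) (U : {set T}) : digraph T :=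
  delete (detour D U) U.

(* D / W is a digraph on option T: None is the new vertex {W}, and Some x is
   the old vertex x. In the mixed cases x must lie outside W, since otherwise
   Some x is not a vertex of D / W. *)
Definition contract_adjacency (T : finType) (D : digraph T) (W : {set T}) :
    {ffun option T * option T -> bool} :=
  [ffun p => match p with
    | (Some x, Some y) => [&& x \notin W, y \notin W & mu D x y]
    | (Some x, None) => (x \notin W) && \big[orb/false]_(z in W) mu D x z
    | (None, Some x) => (x \notin W) && \big[orb/false]_(z in W) mu D z x
    | (None, None) => false
    end].

Lemma contract_proof (T : finType) (D : digraph T) (W : {set T}) :
  loopless_on (None |: Some @: (vertices D :\: W)) (contract_adjacency D W).
Proof.
have SomeP z : (Some z \in None |: Some @: (vertices D :\: W)) =
    (z \notin W) && (z \in vertices D).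
  by rewrite !inE /= mem_imset ?inE //; apply: Some_inj.
have NoneP : None \in None |: Some @: (vertices D :\: W) by rewrite setU11.
apply/forallP => x; apply/forallP => y; apply/implyP; rewrite ffunE.
case: x y => [x|] [y|] //; rewrite ?SomeP ?NoneP //=.
- by case/and3P=> -> -> /mu_vertices.
- by case/andP=> ->; rewrite big_orE => /existsP[z /andP[_ /mu_vertices/and3P[->]]].
- by case/andP=> ->; rewrite big_orE => /existsP[z /andP[_ /mu_vertices/and3P[_ ->]]].
Qed.

Definition contract (T : finType) (D : digraph T) (W : {set T}) :
    digraph (option T) :=
  Digraph (contract_proof D W).

(* Ambient type of the vertices after m successive contractions, and the
   identification of the old vertices with elements of it. *)
Fixpoint contracted (T : finType) (m : nat) : finType :=
  if m is m'.+1 then option (contracted T m') else T.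

Fixpoint old_vertex (T : finType) (m : nat) : T -> contracted T m :=
  if m is m'.+1 then fun x => Some (old_vertex m' x) else id.

(* (... (D / V_0) / ...) / V_(m-1) *)
Fixpoint contractions (T : finType) (D : digraph T) (m : nat) :
    ('I_m -> {set T}) -> digraph (contracted T m) :=
  if m is m'.+1 then fun V =>
    contract (contractions D (fun i : 'I_m' => V (widen_ord (leqnSn m') i)))
             (old_vertex m' @: V ord_max)
  else fun _ => D.

(* Main.v *)
(** A detour at a vertex [u] only composes arcs through [u], and a contraction
    of [W] takes the disjunction of the arcs at [W].  When [u] lies outside [W]
    these two operations commute by distributivity; vertex deletion commutes
    with contraction in the same way.  The theorem follows by induction on the
    detoured vertices and on the number of contractions. *)
Require Import Defs.
From HB Require Import structures.
From mathcomp Require Import all_boot.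

Set Implicit Arguments.
Unset Strict Implicit.
Unset Printing Implicit Defensive.

(** The third field of a [digraph] is a boolean equation, so any two proofs of it coincide. *)
Lemma digraph_eq (T : finType) (D E : digraph T) :
  vertices D = vertices E -> mu D =2 mu E -> D = E.
Proof.
case: D E => [V m mP] [V' m' m'P] /= eqV; rewrite -{}eqV in m'P *.
move=> eq_mu; have eqm : m = m' by apply/ffunP=> -[x y]; apply: eq_mu.
by rewrite -{}eqm in m'P {eq_mu} *; congr Digraph; apply: bool_irrelevance.
Qed.

Lemma mu_neq (T : finType) (D : digraph T) (x y : T) : mu D x y -> x != y.
Proof. by case/mu_vertices/and3P. Qed.

Lemma mem_predecessors (T : finType) (D : digraph T) (v x : T) :
  (x \in predecessors D v) = mu D x v.
Proof.
rewrite !inE; case: (boolP (mu D x v)); last by rewrite andbF.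
by case/mu_vertices/and3P=> -> _ ->.
Qed.

Lemma mem_successors (T : finType) (D : digraph T) (v x : T) :
  (x \in successors D v) = mu D v x.
Proof.
rewrite !inE; case: (boolP (mu D v x)); last by rewrite andbF.
by case/mu_vertices/and3P=> _ ->; rewrite eq_sym => ->.
Qed.

(** As [D] has no loops, every arc at [v] is deleted and none is created there. So [v] becomes
    isolated, and the nested conditionals collapse to one boolean formula. *)
Lemma mu_detour1 (T : finType) (D : digraph T) (v x y : T) :
  mu (detour1 D v) x y =
  [&& x != v, y != v & mu D x y || [&& mu D x v, mu D v y & x != y]].
Proof.
rewrite {1}/mu /= ffunE !mem_predecessors !mem_successors.
have muvv : mu D v v = false by apply/negP => /mu_neq; rewrite eqxx.
have [->|_] := eqVneq x v; first by rewrite muvv /=; case: (mu D v y).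
have [->|_] := eqVneq y v; first by rewrite muvv andbF /=; case: (mu D x v).
by rewrite andbF /=; case: ifP; rewrite ?orbT ?orbF.
Qed.

Lemma mu_delete (T : finType) (D : digraph T) (U : {set T}) (x y : T) :
  mu (delete D U) x y = [&& x \notin U, y \notin U & mu D x y].
Proof. by rewrite {1}/mu /= ffunE. Qed.

Lemma mu_contract (T : finType) (D : digraph T) (W : {set T})
    (a b : option T) :
  mu (contract D W) a b =
  match a, b with
  | Some x, Some y => [&& x \notin W, y \notin W & mu D x y]
  | Some x, None => (x \notin W) && [exists z in W, mu D x z]
  | None, Some x => (x \notin W) && [exists z in W, mu D z x]
  | None, None => false
  end.
Proof. by rewrite {1}/mu /= ffunE; case: a b => [x|] [y|]; rewrite ?big_orE. Qed.

Lemma contract_detour1 (T : finType) (D : digraph T) (W : {set T}) (u : T) :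
  u \notin W -> contract (detour1 D u) W = detour1 (contract D W) (Some u).
Proof.
move=> uW; have neq_u z : z \in W -> z != u by apply: contraTneq => ->.
apply: digraph_eq => // -[x|] [y|]; rewrite mu_detour1 !mu_contract ?uW //=.
- rewrite mu_detour1 !(inj_eq Some_inj).
  by case: (x \in W); case: (y \in W); rewrite ?andbF.
- rewrite (inj_eq Some_inj) andbT; have [xW|xW] := boolP (x \in W);
    first by rewrite andbF.
  (* The arc into the new vertex comes either from an arc of [D] into some [z] in [W], or from a
     path through [u] to such a [z]. *)
  apply/exists_inP/andP => [[z zW]|[xu /orP[|/andP[/= xu_arc]]]].
  + rewrite mu_detour1 => /and3P[-> _ /orP[xz|/and3P[-> uz _]]]; split=> //.
      by apply/orP; left; apply/exists_inP; exists z.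
    by apply/orP; right; apply/exists_inP; exists z.
  + case/exists_inP=> z zW xz; exists z => //.
    by rewrite mu_detour1 xu neq_u ?xz.
  + case/exists_inP=> z zW uz; exists z => //.
    (* The guard [x != z] of the detour holds because [z] lies in [W] and [x] does not. *)
    by rewrite mu_detour1 xu neq_u //= xu_arc uz eq_sym (memPn xW z zW) orbT.
- rewrite (inj_eq Some_inj); have [yW|yW] := boolP (y \in W);
    first by rewrite /= !andbF.
  apply/exists_inP/andP => [[z zW]|[yu /orP[|/and3P[]]]].
  + rewrite mu_detour1 => /and3P[_ -> /orP[zy|/and3P[zu -> _]]]; split=> //.
      by apply/orP; left; apply/exists_inP; exists z.
    by rewrite /= !andbT; apply/orP; right; apply/exists_inP; exists z.
  + case/exists_inP=> z zW zy; exists z => //.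
    by rewrite mu_detour1 yu neq_u ?zy.
  + case/exists_inP=> z zW zu /= uy _; exists z => //.
    by rewrite mu_detour1 yu neq_u //= zu uy (memPn yW z zW) orbT.
(* A path from the new vertex through [u] and back would give a loop, which the guard of the detour
   suppresses. *)
- by rewrite !andbF.
Qed.

(** [detour] folds along [enum]; since [Some] preserves the enumeration order, the detours before
    and after a contraction are performed in the same order. *)
Lemma enum_imset_Some (T : finType) (U : {set T}) :
  enum (Some @: U) = map Some (enum U).
Proof.
have enum_option : enum {: option T} = None :: map Some (enum T).
  by rewrite !enumT {1}unlock.
rewrite /enum_mem -!enumT enum_option /=.
have /negPf-> : None \notin Some @: U by apply/negP => /imsetP[].
rewrite filter_map; congr map; apply: eq_filter => x /=.
by rewrite mem_imset //; apply: Some_inj.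
Qed.

Lemma contract_detour (T : finType) (D : digraph T) (U W : {set T}) :
  [disjoint U & W] ->
  contract (detour D U) W = detour (contract D W) (Some @: U).
Proof.
move=> dUW; rewrite /detour enum_imset_Some.
(* Disjointness is restated along the list so that the induction can pass it to the tail. *)
have : all [predC W] (enum U).
  by apply/allP=> u; rewrite mem_enum => /(disjointFr dUW)/= ->.
elim: (enum U) D => //= u s IHs D /andP[uW sW].
by rewrite IHs // contract_detour1.
Qed.

Lemma contract_delete (T : finType) (D : digraph T) (U W : {set T}) :
  [disjoint U & W] ->
  contract (delete D U) W = delete (contract D W) (Some @: U).
Proof.
move=> dUW; have SomeU x : (Some x \in Some @: U) = (x \in U).
  by rewrite mem_imset //; apply: Some_inj.
have NoneU : (None \in Some @: U) = false by apply/negP => /imsetP[].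
(* Deletion spares all of [W], so the disjunctions over [W] keep all their terms. *)
have WU z : z \in W -> z \notin U by move/(disjointFl dUW)->.
apply: digraph_eq => [|[x|] [y|]].
- apply/setP=> -[x|]; rewrite !inE ?NoneU //= SomeU.
  by rewrite !mem_imset ?inE; [rewrite andbCA | apply: Some_inj..].
- rewrite mu_delete !mu_contract mu_delete !SomeU.
  by case: (x \in W) (y \in W) (x \in U) (y \in U) => [] [] [] [].
- rewrite mu_delete !mu_contract SomeU NoneU /= andbCA; congr andb.
  apply/exists_inP/andP => [[z zW]|[xU /exists_inP[z zW xz]]].
    by rewrite mu_delete => /and3P[-> _ xz]; split=> //; apply/exists_inP; exists z.
  by exists z; rewrite ?mu_delete ?xU ?WU.
- rewrite mu_delete !mu_contract SomeU NoneU /= andbCA; congr andb.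
  apply/exists_inP/andP => [[z zW]|[yU /exists_inP[z zW zy]]].
    by rewrite mu_delete => /and3P[_ -> zy]; split=> //; apply/exists_inP; exists z.
  by exists z; rewrite ?mu_delete ?yU ?WU.
- by rewrite mu_delete !mu_contract !andbF.
Qed.

Lemma old_vertex_inj (T : finType) (m : nat) : injective (@old_vertex T m).
Proof. by elim: m => [|m IHm] x y //= [/IHm]. Qed.

Lemma old_vertex_imsetS (T : finType) (m : nat) (U : {set T}) :
  old_vertex m.+1 @: U = Some @: (old_vertex m @: U).
Proof. by rewrite -imset_comp. Qed.

Lemma contractions_detour (T : finType) (D : digraph T) (U : {set T})
    (m : nat) (V : 'I_m -> {set T}) :
  (forall i, [disjoint U & V i]) ->
  contractions (detour D U) V = detour (contractions D V) (old_vertex m @: U).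
Proof.
elim: m V => [|m IHm] V dUV; first by rewrite imset_id.
rewrite old_vertex_imsetS /= IHm // contract_detour //.
(* Injectivity of [old_vertex] carries the disjointness of [U] and the last [V i] over to their
   images. *)
by rewrite (imset_disjoint (@old_vertex_inj T m)).
Qed.

Lemma contractions_delete (T : finType) (D : digraph T) (U : {set T})
    (m : nat) (V : 'I_m -> {set T}) :
  (forall i, [disjoint U & V i]) ->
  contractions (delete D U) V = delete (contractions D V) (old_vertex m @: U).
Proof.
elim: m V => [|m IHm] V dUV; first by rewrite imset_id.
rewrite old_vertex_imsetS /= IHm // contract_delete //.
by rewrite (imset_disjoint (@old_vertex_inj T m)).
Qed.

Theorem mainTheorem7 (T : finType) (D : digraph T) (U : {set T})
    (m : nat) (V : 'I_m -> {set T})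
    (sUD : U \subset vertices D)
    (sVD : forall i, V i \subset vertices D)
    (disjUV : forall i, [disjoint U & V i])
    (disjV : forall i j, i != j -> [disjoint V i & V j]) :
  contractions (detour D U) V = detour (contractions D V) (old_vertex m @: U)
  /\
  contractions (bypass D U) V = bypass (contractions D V) (old_vertex m @: U).
Proof.
split; first exact: contractions_detour.
by rewrite /bypass contractions_delete // contractions_detour.
Qed.
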